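(* Let $k$ be a field of characteristic zero and let $k[[X]]=k[[X_1,\ldots,X_n]]$ be the ring of formal power series in $n$ variables with coefficients in $k$. Let $f_1,\ldots,f_n\in k[[X_1,\ldots,X_n]]$ generate a proper ideal. Then the following properties are equivalent: (1) $\operatorname{Dim} k[[X]]/(f_1,\ldots,f_n)>0$; (2) the Jacobian $J_X(f_1,\ldots,f_n)$ belongs to the ideal $(f_1,\ldots,f_n)k[[X]]$. Moreover, if $\dim_k \frac{k[[X_1,\ldots,X_n]]}{(f_1,\ldots,f_n)}<+\infty$ (dimension as a $k$-vector space), i.e. if $\operatorname{Dim}\frac{k[[X_1,\ldots,X_n]]}{(f_1,\ldots,f_n)}=0$, then $$J_X(f_1,\ldots,f_n)\cdot(X_1,\ldots,X_n)\subset (f_1,\ldots,f_n).$$ In other words, the class of $J_X(f_1,\ldots,f_n)$ in $\frac{k[[X_1,\ldots,X_n]]}{(f_1,\ldots,f_n)}$ is a generator of the socle of this Artinian algebra.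
   Context: $\operatorname{Dim}$ denotes the Krull dimension of a ring. The Jacobian is $J_X(f_1,\ldots,f_n)=\det\left(\frac{\partial f_i}{\partial X_j}\right)_{1\le i,j\le n}$. The socle of an Artinian local ring $P$ with maximal ideal $\mathfrak{m}_P$ is $\{x\in P : \mathfrak{m}_P\, x=0\}$. *)

(* Defs.v *)
From HB Require Import structures.
From mathcomp Require Import all_boot all_algebra.
From mathcomp Require Import generic_quotient ring_quotient.
From mathcomp Require Import boolp.
From mathcomp Require Import mpoly.

Set Implicit Arguments.
Unset Strict Implicit.
Unset Printing Implicit Defensive.

Import GRing.Theory.
Local Open Scope ring_scope.
Local Open Scope quotient_scope.

(** * Formal power series in [n] variables *)

(* A series is the family of its coefficients, indexed by the monomials of
   [mpoly]: the series with coefficients [f] is [\sum_m f m X^m]. *)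
Record mpseries (n : nat) (R : Type) := MPSeries { pscoef : 'X_{1..n} -> R }.

Notation "{ 'mpseries' R [ n ] }" := (mpseries n R)
  (at level 0, R, n at level 2, format "{ 'mpseries'  R [ n ] }").

HB.instance Definition _ n R := gen_eqMixin {mpseries R[n]}.
HB.instance Definition _ n R := gen_choiceMixin {mpseries R[n]}.

Lemma mpseriesP n R (f g : {mpseries R[n]}) : pscoef f =1 pscoef g -> f = g.
Proof. by case: f => f; case: g => g /= /funext ->. Qed.

Section Ring.
Variables (n : nat) (R : comNzRingType).
Implicit Types f g h : {mpseries R[n]}.

Definition ps0 : {mpseries R[n]} := MPSeries (fun=> 0).
Definition psopp f := MPSeries (fun m => - pscoef f m).
Definition psadd f g := MPSeries (fun m => pscoef f m + pscoef g m).
Definition ps1 : {mpseries R[n]} := MPSeries (fun m => (m == 0%MM)%:R).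
Definition psscale (c : R) f := MPSeries (fun m => c * pscoef f m).

(* The degree bounds only serve to make the index type finite: both factors of
   [m] have degree at most [mdeg m]. *)
Definition psmul f g := MPSeries (fun m =>
  \sum_(a : 'X_{1..n < (mdeg m).+1, (mdeg m).+1} | m == (a.1 + a.2)%MM)
     pscoef f a.1 * pscoef g a.2).

Fact psaddA : associative psadd.
Proof. by move=> f g h; apply: mpseriesP => m /=; rewrite addrA. Qed.
Fact psaddC : commutative psadd.
Proof. by move=> f g; apply: mpseriesP => m /=; rewrite addrC. Qed.
Fact psadd0 : left_id ps0 psadd.
Proof. by move=> f; apply: mpseriesP => m /=; rewrite add0r. Qed.
Fact psaddN : left_inverse ps0 psopp psadd.
Proof. by move=> f; apply: mpseriesP => m /=; rewrite addNr. Qed.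

HB.instance Definition _ :=
  GRing.isZmodule.Build {mpseries R[n]} psaddA psaddC psadd0 psaddN.

(* Truncation to a polynomial, used to transfer the ring axioms from [mpoly]. *)
Definition pstrunc d f : {mpoly R[n]} :=
  \sum_(a : 'X_{1..n < d}) pscoef f a *: 'X_[a].

Lemma mcoeff_pstrunc d f m : (mdeg m < d)%N -> (pstrunc d f)@_m = pscoef f m.
Proof.
move=> md; rewrite /pstrunc raddf_sum /= (bigD1 (BMultinom md)) //=.
rewrite mcoeffZ mcoeffX eqxx mulr1 big1 ?addr0 // => a am.
rewrite mcoeffZ mcoeffX; case: eqP => [e|_]; last by rewrite mulr0.
by case/eqP: am; apply: val_inj.
Qed.

Lemma mcoeff_pstruncM d f g m : (mdeg m < d)%N ->
  (pstrunc d f * pstrunc d g)@_m = pscoef (psmul f g) m.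
Proof.
move=> md; rewrite mcoeffM; apply: eq_bigr => -[a b] /= _.
by rewrite !mcoeff_pstrunc // (leq_trans _ md) // ltnS -ltnS bmdeg.
Qed.

Lemma psmul_trunc (p q : {mpoly R[n]}) f g m :
    (forall a, (mdeg a <= mdeg m)%N -> p@_a = pscoef f a) ->
    (forall a, (mdeg a <= mdeg m)%N -> q@_a = pscoef g a) ->
  pscoef (psmul f g) m = (p * q)@_m.
Proof.
move=> pf qg; rewrite mcoeffM; apply: eq_bigr => -[a b] /= _.
by rewrite pf ?qg // -ltnS bmdeg.
Qed.

Fact psmulC : commutative psmul.
Proof.
move=> f g; apply: mpseriesP => m.
by rewrite -!(mcoeff_pstruncM _ _ (ltnSn _)) mulrC.
Qed.
Fact psmulA : associative psmul.
Proof.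
move=> f g h; apply: mpseriesP => m; set d := (mdeg m).+1.
rewrite (@psmul_trunc (pstrunc d f) (pstrunc d g * pstrunc d h)); first last.
- by move=> a am; rewrite mcoeff_pstruncM.
- by move=> a am; rewrite mcoeff_pstrunc.
rewrite (@psmul_trunc (pstrunc d f * pstrunc d g) (pstrunc d h)) ?mulrA //.
- by move=> a am; rewrite mcoeff_pstruncM.
- by move=> a am; rewrite mcoeff_pstrunc.
Qed.
Fact psmul1 : left_id ps1 psmul.
Proof.
move=> f; apply: mpseriesP => m.
rewrite (@psmul_trunc 1 (pstrunc (mdeg m).+1 f)).
- by rewrite mul1r mcoeff_pstrunc.
- by move=> a _; rewrite mcoeff1.
- by move=> a am; rewrite mcoeff_pstrunc.
Qed.
Fact psmulDl : left_distributive psmul psadd.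
Proof.
move=> f g h; apply: mpseriesP => m /=; rewrite -big_split.
by apply: eq_bigr => a _; rewrite mulrDl.
Qed.
Fact ps1_neq0 : ps1 != 0.
Proof.
apply/eqP => /(congr1 (fun f => pscoef f 0%MM)) /=.
by rewrite eqxx; apply/eqP/oner_neq0.
Qed.

HB.instance Definition _ :=
  GRing.Zmodule_isComNzRing.Build {mpseries R[n]}
    psmulA psmulC psmul1 psmulDl ps1_neq0.

Fact psscaleA a b f : psscale a (psscale b f) = psscale (a * b) f.
Proof. by apply: mpseriesP => m /=; rewrite mulrA. Qed.
Fact psscale1 : left_id 1 psscale.
Proof. by move=> f; apply: mpseriesP => m /=; rewrite mul1r. Qed.
Fact psscaleDr : right_distributive psscale +%R.
Proof. by move=> c f g; apply: mpseriesP => m /=; rewrite mulrDr. Qed.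
Fact psscaleDl f : {morph psscale^~ f : a b / a + b}.
Proof. by move=> a b; apply: mpseriesP => m /=; rewrite mulrDl. Qed.

HB.instance Definition _ := GRing.Zmodule_isLmodule.Build R {mpseries R[n]}
  psscaleA psscale1 psscaleDr psscaleDl.

Fact psscaleAl (c : R) f g : c *: (f * g) = c *: f * g.
Proof.
apply: mpseriesP => m /=; rewrite mulr_sumr.
by apply: eq_bigr => a _; rewrite mulrA.
Qed.

HB.instance Definition _ :=
  GRing.Lmodule_isLalgebra.Build R {mpseries R[n]} psscaleAl.
HB.instance Definition _ :=
  GRing.Lalgebra_isComAlgebra.Build R {mpseries R[n]}.

Definition psX (i : 'I_n) : {mpseries R[n]} :=
  MPSeries (fun m => (m == U_(i)%MM)%:R).

(* The coefficient of [X^m] comes from [X^(m + U_i)], whose [i]-th exponent is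
   [m i + 1]. *)
Definition psderiv (i : 'I_n) f : {mpseries R[n]} :=
  MPSeries (fun m => pscoef f (m + U_(i))%MM *+ (m i).+1).

Definition jacobian (f : 'I_n -> {mpseries R[n]}) : {mpseries R[n]} :=
  \det (\matrix_(i, j) psderiv j (f i)).

End Ring.

Arguments psX {n R} i.

(** * Ideals and quotients *)

Section GeneratedIdeal.
Variables (A : comNzRingType) (I : finType) (x : I -> A).

Definition ideal_gen : {pred A} :=
  fun a => `[< exists c : I -> A, a = \sum_i c i * x i >].

Fact ideal_gen_closed : 1 \notin ideal_gen -> idealr_closed ideal_gen.
Proof.
move=> x1; split=> // [|a u v /asboolP [c ->] /asboolP [d ->]]; apply/asboolP.
  by exists (fun=> 0); rewrite big1 // => i _; rewrite mul0r.
exists (fun i => a * c i + d i); rewrite mulr_sumr -big_split.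
by apply: eq_bigr => i _; rewrite mulrDl mulrA.
Qed.

(* [idealr] is the type of proper ideals. *)
Definition proper_gen (x1 : 1 \notin ideal_gen) : idealr A :=
  HB.pack (ideal_gen : A -> bool) (isIdealr.Build A _ (ideal_gen_closed x1)).

End GeneratedIdeal.

Section QuotientAlgebra.
Variables (k : comNzRingType) (A : comAlgType k) (I : idealr A).
Local Notation Q := {ideal_quot I}.

Definition quot_scale (c : k) (u : Q) : Q := \pi_Q (c%:A) * u.

Fact quot_scaleA a b u : quot_scale a (quot_scale b u) = quot_scale (a * b) u.
Proof. by rewrite /quot_scale mulrA -rmorphM -scalerAl mul1r scalerA. Qed.
Fact quot_scale1 : left_id 1 quot_scale.
Proof. by move=> u; rewrite /quot_scale scale1r rmorph1 mul1r. Qed.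
Fact quot_scaleDr : right_distributive quot_scale +%R.
Proof. by move=> c u v; rewrite /quot_scale mulrDr. Qed.
Fact quot_scaleDl u : {morph quot_scale^~ u : a b / a + b}.
Proof. by move=> a b; rewrite /quot_scale scalerDl rmorphD mulrDl. Qed.

HB.instance Definition _ := GRing.Zmodule_isLmodule.Build k Q
  quot_scaleA quot_scale1 quot_scaleDr quot_scaleDl.

End QuotientAlgebra.

Definition finite_dim (k : fieldType) (V : lmodType k) : Prop :=
  exists (d : nat) (e : 'I_d -> V),
    forall v, exists c : 'I_d -> k, v = \sum_i c i *: e i.

(** * Commutative algebra *)

Section CommutativeAlgebra.
Variable A : comNzRingType.

(* A chain [P 0 < P 1 < ... < P d] of prime ideals. *)
Definition has_prime_chain (d : nat) : Prop :=
  exists P : nat -> prime_idealr A, forall i, (i < d)%N ->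
    {subset P i <= P i.+1} /\ ~ {subset P i.+1 <= P i}.

(* The Krull dimension is the supremum of the lengths of the chains of prime
   ideals, possibly infinite: [krull_dim d] says that it equals [d], and
   [krull_dim_gt d] that it is greater than [d]. *)
Definition krull_dim (d : nat) : Prop :=
  has_prime_chain d /\ forall e, has_prime_chain e -> (e <= d)%N.

Definition krull_dim_gt (d : nat) : Prop :=
  exists2 e, (d < e)%N & has_prime_chain e.

(* Only proper ideals are quantified over: a descending chain that is not
   constantly [A] consists of proper ideals from some index on. *)
Definition artinian : Prop :=
  forall I : nat -> idealr A, (forall i, {subset I i.+1 <= I i}) ->
    exists N, forall i, (N <= i)%N -> I i =i I N.

Definition maximal_ideal (M : idealr A) : Prop :=
  forall J : idealr A, {subset M <= J} -> J =i M.

(* [A] is a local ring, with maximal ideal [M]. *)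
Definition local_ring (M : idealr A) : Prop :=
  maximal_ideal M /\ forall J : idealr A, maximal_ideal J -> J =i M.

Definition socle (M : idealr A) : {pred A} :=
  fun x => `[< forall m, m \in M -> m * x = 0 >].

End CommutativeAlgebra.

(* Main.v *)
Require Import Defs.
From HB Require Import structures.
From mathcomp Require Import all_boot all_algebra.
From mathcomp Require Import generic_quotient ring_quotient.
From mathcomp Require Import boolp.
From mathcomp Require Import mpoly ring zify.
From mathcomp Require classical_sets.

Set Implicit Arguments.
Unset Strict Implicit.
Unset Printing Implicit Defensive.

Import GRing.Theory.
Local Open Scope ring_scope.
Local Open Scope quotient_scope.

(** Let [P = k[[X]]], with maximal ideal [m], and [J] the Jacobian of [f].
    Both halves of the theorem rest on one determinant in two sets of variables.
    Write [f_i(Y) - f_i(X) = \sum_j Delta_ij (Y_j - X_j)] and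
    [D = \det Delta = \sum_i a_i(X) b_i(Y)]. By Cramer's rule, [X_j D = Y_j D]
    modulo [(f(X), f(Y))]; and [D(X, X) = J]. So for a linear form
    [lam] on [P] that kills [(f)] and a power of [m], the finite rank operator
    [g |-> \sum_i lam (g a_i) b_i] is, modulo [(f)], the multiplication by the
    single series [u = \sum_i lam (a_i) b_i], and its trace is
    [\sum_i lam (a_i b_i) = lam J] (lemmas [jacobian_kernel] and
    [dual_trace_nilpotent]). The series [f_i] are truncated at a high order, so
    that [D] is a polynomial in [Y]; this is harmless modulo high powers of [m].

    Suppose that [P/(f)] is infinite dimensional. Then [u] is never a unit,
    since otherwise an operator of finite rank would be invertible; so it is
    nilpotent on the relevant finite dimensional space, and [lam J = 0] for every
    [lam]. Hence [J] lies in [(f) + m^L] for all [L], and in [(f)] because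
    finitely generated ideals of [P] are closed ([ideal_gen_closed_adic]). This
    is [jacobian_in_ideal].

    Suppose that [P/(f)] is finite dimensional. If some [lam] has a unit for
    [u], then it can be normalized to [u = 1], and [lam (g J)] is the trace of
    the multiplication by [g]: in characteristic zero it is nonzero for [g = 1],
    and it is zero for [g] in [m]. The reproducing formula
    [g = \sum_i lam (g a_i) b_i] then yields at once that [J] is not in [(f)],
    that [m J] is, and that [J] spans the socle. The constant coefficient of [u]
    is [lam (\det B)], where [f_i = \sum_j B_ij X_j], so a form with
    [lam (\det B) = 1] is wanted. The residue is one ([residue_functional]):
    with [X_i^(K+1) = \sum_j A_ij f_j] it sends [h] to the coefficient of
    [\prod_i X_i^K] in [h \det A], and [\det (A B)] has coefficient [1] there.

    For the dimensions, the quotient is finite dimensional, or of Krull dimension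
    zero, exactly when the [X_j] are nilpotent in it: all primes contain the
    nilpotent elements, and [prime_avoiding] gives a prime that misses a
    non nilpotent [X_j]. *)

(** * Subspaces and traces *)

Section LinearAlgebra.
Variable k : fieldType.

Definition subspace d (S : 'rV[k]_d -> Prop) :=
  S 0 /\ forall a u v, S u -> S v -> S (a *: u + v).

Lemma subspace_submx d m (S : 'rV[k]_d -> Prop) (W : 'M_(m, d)) v :
  subspace S -> (forall i, S (row i W)) -> (v <= W)%MS -> S v.
Proof.
move=> [S0 SD] SW /submxP [c ->]; rewrite mulmx_sum_row.
by elim/big_rec: _ => // i u _ Su; apply: SD.
Qed.

(** The matrix is one of maximal rank among those whose rows lie in [S]. *)
Lemma subspace_mx d (S : 'rV[k]_d -> Prop) : subspace S ->
  exists W : 'M[k]_d, forall v, S v <-> (v <= W)%MS.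
Proof.
move=> SS; pose P r := `[< exists2 W : 'M[k]_d, \rank W = r & forall i, S (row i W) >].
have P0 : exists r, P r.
  exists 0%N; apply/asboolP; exists 0; first exact: mxrank0.
  by move=> i; rewrite row0; case: SS.
have Pd r : P r -> (r <= d)%N by case/asboolP => W <- _; apply: rank_leq_row.
case: (ex_maxnP P0 Pd) => r /asboolP [W Wr SW] rmax.
exists W => v; split=> [Sv|]; last exact: subspace_submx.
have SWv i : S (row i (W + v)%MS).
  have Scol j : S (row j (col_mx W v)).
    rewrite -(splitK j); case: (split j) => l /=.
      by rewrite rowKu; apply: SW.
    by rewrite rowKd [l]ord1 row_id.
  by apply: (subspace_submx SS Scol); rewrite -addsmxE row_sub.
have /rmax : P (\rank (W + v)%MS) by apply/asboolP; exists (W + v)%MS.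
rewrite -Wr => le_r; apply: submx_trans (addsmxSr W v) _.
by rewrite -(geq_leqif (mxrank_leqif_sup (addsmxSl W v))).
Qed.

Lemma subspace_separate d (S : 'rV[k]_d -> Prop) v : subspace S -> ~ S v ->
  exists phi : 'cV[k]_d, (forall u, S u -> u *m phi = 0) /\ v *m phi != 0.
Proof.
move=> /subspace_mx [W SW] nSv.
have : ~~ (v <= W)%MS by apply/negP => /SW.
rewrite submxE => /eqP nz.
case: (pselect (exists j, v *m col j (cokermx W) != 0)) => [[j jP]|all0].
  exists (col j (cokermx W)); split=> // u /SW; rewrite submxE => /eqP u0.
  by rewrite colE mulmxA u0 mul0mx.
case: nz; apply/matrixP => i j; rewrite [RHS]mxE.
have vj : v *m col j (cokermx W) = 0.
  by apply/eqP/negPn/negP => vj; apply: all0; exists j.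
by have /matrixP/(_ i 0) := vj; rewrite colE mulmxA -colE !mxE.
Qed.

(** The dimensions decrease, hence are constant from some index on. *)
Lemma subspace_stationary d (S : nat -> 'rV[k]_d -> Prop) :
    (forall i, subspace (S i)) -> (forall i v, S i.+1 v -> S i v) ->
  exists N, forall i, (N <= i)%N -> forall v, S N v -> S i v.
Proof.
move=> SS Sdec; have Sle i j v : (i <= j)%N -> S j v -> S i v.
  by move=> /subnK <-; elim: (j - i)%N v => // l IH v /Sdec; apply: IH.
have [W SW] := choice (fun i => subspace_mx (SS i)).
pose P r := `[< exists i, \rank (W i) = r >].
have P0 : exists r, P r by exists (\rank (W 0%N)); apply/asboolP; exists 0%N.
case: (ex_minnP P0) => r /asboolP [N WN] rmin; exists N => i Ni v.
have WiN : (W i <= W N)%MS.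
  by apply/row_subP => j; apply/SW/(Sle _ i) => //; apply/SW/row_sub.
have le_r : (\rank (W N) <= \rank (W i))%N.
  by rewrite WN; apply: rmin; apply/asboolP; exists i.
rewrite (geq_leqif (mxrank_leqif_sup WiN)) in le_r.
by move=> /SW vN; apply/SW; apply: submx_trans le_r.
Qed.

(** A full rank factorization [A = C R] gives [tr A = tr (R C)], and [R C] has
    a smaller index of nilpotency than [A]. *)
Lemma mxtrace_nilpotent N d (A : 'M[k]_d) : A ^+ N = 0 -> \tr A = 0.
Proof.
elim: N d A => [|N IH] d A AN.
  by rewrite -[A]mulr1 -(expr0 A) AN mulr0 raddf0.
set C := col_base A; set R := row_base A.
have AE : C *m R = A by apply: mulmx_base.
have powE j : A ^+ j.+1 = C *m ((R *m C) ^+ j) *m R.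
  elim: j => [|j IHj]; first by rewrite expr1 expr0 mulmx1.
  rewrite exprSr IHj exprSr -!mulmxE.
  transitivity (C *m (R *m C) ^+ j *m R *m (C *m R)).
    by rewrite AE.
  by rewrite !mulmxA.
rewrite -AE mxtrace_mulC; apply: IH.
apply: (row_full_inj (col_base_full A)); apply: (row_free_inj (row_base_free A)).
by rewrite -[LHS]powE AN mulmx0 mul0mx.
Qed.

Lemma mxtrace_idempotent d (A : 'M[k]_d) :
  A *m A = A -> \tr A = (\rank A)%:R.
Proof.
move=> AA; set C := col_base A; set R := row_base A.
have AE : C *m R = A by apply: mulmx_base.
rewrite -AE mxtrace_mulC; suff -> : R *m C = 1%:M by rewrite mxtrace1 AE.
apply: (row_full_inj (col_base_full A)); apply: (row_free_inj (row_base_free A)).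
transitivity ((C *m R) *m (C *m R)); first by rewrite /= !mulmxA.
by rewrite /= mulmx1 AE.
Qed.

End LinearAlgebra.

(** * Ideals *)

Section Ideals.
Variable A : comNzRingType.

(** Unlike [idealr_closed], this allows the unit ideal. *)
Definition is_ideal (S : A -> Prop) :=
  [/\ S 0, forall u v, S u -> S v -> S (u + v) & forall a u, S u -> S (a * u)].

Variable S : A -> Prop.
Hypothesis SI : is_ideal S.

Lemma is_ideal0 : S 0. Proof. by case: SI. Qed.
Lemma is_idealD u v : S u -> S v -> S (u + v).
Proof. by case: SI => _ SD _; apply: SD. Qed.
Lemma is_idealMl a u : S u -> S (a * u).
Proof. by case: SI => _ _ SM; apply: SM. Qed.
Lemma is_idealMr a u : S u -> S (u * a).
Proof. by rewrite mulrC; apply: is_idealMl. Qed.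
Lemma is_idealN u : S u -> S (- u).
Proof. by rewrite -mulN1r; apply: is_idealMl. Qed.
Lemma is_idealB u v : S u -> S v -> S (u - v).
Proof. by move=> Su Sv; apply: is_idealD => //; apply: is_idealN. Qed.
Lemma is_idealBl u v : S (u - v) -> S v -> S u.
Proof. by move=> Suv Sv; rewrite -(subrK v u); apply: is_idealD. Qed.
Lemma is_ideal_trans u v w : S (u - v) -> S (v - w) -> S (u - w).
Proof. by move=> Suv Svw; rewrite -(subrKA v); apply: is_idealD. Qed.
Lemma is_ideal_sym u v : S (u - v) -> S (v - u).
Proof. by move/is_idealN; rewrite opprB. Qed.
Lemma is_ideal_sum (J : Type) (r : seq J) (P : pred J) (F : J -> A) :
  (forall i, P i -> S (F i)) -> S (\sum_(i <- r | P i) F i).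
Proof.
move=> SF; elim/big_rec: _ => [|i u Pi Su]; first exact: is_ideal0.
by apply: is_idealD => //; apply: SF.
Qed.
Lemma is_ideal_subM u u' v v' : S (u - u') -> S (v - v') -> S (u * v - u' * v').
Proof.
move=> Su Sv; rewrite -(subrKA (u' * v)) -mulrBl -mulrBr.
by apply: is_idealD; [apply: is_idealMr|apply: is_idealMl].
Qed.

Lemma is_ideal_det d (M N : 'M[A]_d) :
  (forall i j, S (M i j - N i j)) -> S (\det M - \det N).
Proof.
move=> SMN; rewrite /determinant -sumrB; apply: is_ideal_sum => s _.
rewrite -mulrBr; apply: is_idealMl.
elim/big_rec2: _ => [|i u v _ Suv]; first by rewrite subrr; apply: is_ideal0.
exact: is_ideal_subM.
Qed.

End Ideals.

Section GeneratedIdeals.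
Variables (A : comNzRingType) (I : finType) (x : I -> A).

Lemma ideal_genP u :
  reflect (exists c : I -> A, u = \sum_i c i * x i) (u \in ideal_gen x).
Proof. exact: asboolP. Qed.

Lemma ideal_gen_ideal : is_ideal (fun u => u \in ideal_gen x).
Proof.
split=> [|u v /ideal_genP [c ->] /ideal_genP [d ->]|a u /ideal_genP [c ->]];
  apply/ideal_genP.
- by exists (fun=> 0); rewrite big1 // => i _; rewrite mul0r.
- exists (fun i => c i + d i); rewrite -big_split.
  by apply: eq_bigr => i _; rewrite mulrDl.
- exists (fun i => a * c i); rewrite mulr_sumr.
  by apply: eq_bigr => i _; rewrite mulrA.
Qed.

Lemma mem_ideal_gen i : x i \in ideal_gen x.
Proof.
apply/ideal_genP; exists (fun j => (j == i)%:R).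
rewrite (bigD1 i) //= eqxx mul1r big1 ?addr0 // => j /negbTE ->.
by rewrite mul0r.
Qed.

Lemma ideal_gen_sub (S : A -> Prop) u : is_ideal S -> (forall i, S (x i)) ->
  u \in ideal_gen x -> S u.
Proof.
move=> SI Sx /ideal_genP [c ->]; apply: is_ideal_sum => // i _.
by apply: is_idealMl.
Qed.

End GeneratedIdeals.

Lemma principalP (A : comNzRingType) (x u : A) :
  reflect (exists c, u = c * x) (u \in ideal_gen (fun _ : unit => x)).
Proof.
apply: (iffP (ideal_genP _ _)) => -[c ->]; last exists (fun=> c).
  by exists (c tt); rewrite (bigD1 tt) //= big1 ?addr0 //; case.
by rewrite (bigD1 tt) //= big1 ?addr0 //; case.
Qed.

(** * Traces and dual families *)

(** For [u = 1] the hypothesis [dual] says that [b] spans [A] modulo [S], with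
    the values [lam (g * a i)] as coordinates of [g]. For any [u], the operator [g |-> \sum_i lam (g * a i) *: b i] is the
    multiplication by [u] modulo [S], although it has finite rank. *)
Section DualFamilies.
Variables (k : fieldType) (A : comAlgType k) (S : A -> Prop).
Variables (lam : {scalar A}) (d : nat) (a b : 'I_d -> A) (u : A).
Hypothesis SI : is_ideal S.
Hypothesis lamS : forall g, S g -> lam g = 0.
Hypothesis dual : forall g, S (g * u - \sum_i lam (g * a i) *: b i).

Let M g := \matrix_(i, j) lam (g * b j * a i).

Let lam_dual g h : lam (g * (h * u)) = \sum_i lam (h * a i) * lam (g * b i).
Proof.
apply/eqP; rewrite -subr_eq0; apply/eqP.
rewrite -[RHS](lamS (is_idealMl SI g (dual h))) mulrBr linearB /=; congr (_ - _).
rewrite mulr_sumr linear_sum; apply: eq_bigr => i _.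
by rewrite -scalerAr linearZ.
Qed.

Let mulM g h : M g *m M h = M (g * h * u).
Proof.
apply/matrixP => i j; rewrite !mxE.
transitivity (lam (g * a i * (h * b j * u))); last by congr (lam _); ring.
rewrite lam_dual; apply: eq_bigr => l _; rewrite !mxE mulrC; congr (_ * _).
by congr (lam _); ring.
Qed.

Let trM g : \tr (M g) = lam (g * \sum_i a i * b i).
Proof.
rewrite mulr_sumr linear_sum; apply: eq_bigr => i _; rewrite mxE.
by congr (lam _); ring.
Qed.

(** The left-hand side is the trace of [M g], the matrix in the family [b] of
    the multiplication by [g * u]. *)
Lemma dual_trace_nilpotent g s :
  (forall h, lam (h * (g * u) ^+ s) = 0) -> lam (g * \sum_i a i * b i) = 0.
Proof.
move=> gs; rewrite -trM; apply: (@mxtrace_nilpotent _ s.+1).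
have powM j : M g ^+ j.+1 = M (g * (g * u) ^+ j).
  elim: j => [|j IH]; first by rewrite expr1 expr0 mulr1.
  by rewrite exprS IH -mulmxE mulM; congr M; rewrite exprS; ring.
rewrite powM; apply/matrixP => i j; rewrite !mxE -[RHS](gs (g * b j * a i)).
by congr (lam _); ring.
Qed.

(** Here [M 1] is idempotent, so its trace is its rank; it would be the identity
    if [b] were free. *)
Lemma dual_trace_neq0 : [pchar k] =i pred0 -> u = 1 ->
  (exists g, lam g != 0) -> lam (\sum_i a i * b i) != 0.
Proof.
move=> k0 u1 [g lamg]; rewrite -[X in lam X]mul1r -trM.
have M1 : M 1 *m M 1 = M 1 by rewrite mulM u1 !mulr1.
rewrite mxtrace_idempotent // -?(pcharf0P k).
have /(pcharf0P k) -> := k0; rewrite mxrank_eq0.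
apply: contraNneq lamg => /matrixP M0.
have lamb j : lam (b j) = 0.
  have := lam_dual 1 (b j); rewrite u1 mulr1 mul1r => ->.
  rewrite big1 // => i _; have := M0 i j; rewrite !mxE mul1r => ->.
  by rewrite mul0r.
have := lam_dual 1 g; rewrite u1 mulr1 mul1r => ->.
by rewrite big1 // => i _; rewrite mul1r lamb mulr0.
Qed.

End DualFamilies.

(** * Power series and the powers of the maximal ideal *)

Section Series.
Variables (k : fieldType) (n : nat).
Local Notation P := {mpseries k[n]}.
Implicit Types (f g h : P) (m a b : 'X_{1..n}) (L T : nat).

Lemma pscoefM f g m : pscoef (f * g) m =
  \sum_(a : 'X_{1..n < (mdeg m).+1, (mdeg m).+1} | m == (a.1 + a.2)%MM)
     pscoef f a.1 * pscoef g a.2.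
Proof. by []. Qed.

Lemma pscoefD f g m : pscoef (f + g) m = pscoef f m + pscoef g m.
Proof. by []. Qed.
Lemma pscoefB f g m : pscoef (f - g) m = pscoef f m - pscoef g m.
Proof. by []. Qed.
Lemma pscoefZ (c : k) g m : pscoef (c *: g) m = c * pscoef g m.
Proof. by []. Qed.
Lemma pscoef1 m : pscoef (1 : P) m = (m == 0%MM)%:R.
Proof. by []. Qed.
Lemma pscoef_sum (J : Type) (r : seq J) (Q : pred J) (F : J -> P) m :
  pscoef (\sum_(i <- r | Q i) F i) m = \sum_(i <- r | Q i) pscoef (F i) m.
Proof. exact: (big_morph (fun g => pscoef g m)). Qed.

Definition psmono a : P := MPSeries (fun m => (m == a)%:R).

Lemma psmonoM a g m :
  pscoef (psmono a * g) m = if (a <= m)%MM then pscoef g (m - a)%MM else 0.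
Proof.
rewrite pscoefM; case: ifPn => [am|nam].
  have da : (mdeg a < (mdeg m).+1)%N by rewrite ltnS -(submK am) mdegD leq_addl.
  have db : (mdeg (m - a) < (mdeg m).+1)%N by rewrite ltnS mdegB.
  rewrite (bigD1 (BMultinom da, BMultinom db)) /=; last first.
    by rewrite addmC submK.
  rewrite eqxx mul1r big1 ?addr0 // => -[c d] /= /andP [/eqP me ne].
  case: eqP => [ca|]; last by rewrite mul0r.
  case/eqP: ne; congr (_, _); apply: val_inj => //=.
  by have := congr1 (fun e => (e - c)%MM) me; rewrite /= addmC addmK ca => <-.
rewrite big1 // => -[c d] /= /eqP me; case: eqP => [ca|]; last by rewrite mul0r.
by case/negP: nam; rewrite me ca lem_addr.
Qed.

Lemma psmono0 : psmono 0%MM = 1.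
Proof. by []. Qed.

Lemma psmonoD a b : psmono (a + b)%MM = psmono a * psmono b.
Proof.
apply: mpseriesP => m; rewrite psmonoM /=; case: ifPn => [am|nam].
  by rewrite -[in LHS](submK am) [X in X == _]addmC eqm_add2l.
by case: eqP nam => // ->; rewrite lem_addr.
Qed.

Lemma psmonoE m : psmono m = \prod_(i < n) psX i ^+ m i.
Proof.
rewrite [in LHS](multinomUE_id m).
rewrite (big_morph psmono psmonoD psmono0); apply: eq_bigr => i _.
elim: (m i) => [|j IH]; first by rewrite mulm0n expr0.
by rewrite mulmS psmonoD IH exprS.
Qed.

(** The [L]-th power of the maximal ideal, as a condition on coefficients. *)
Definition ord_ge L g := forall m, (mdeg m < L)%N -> pscoef g m = 0.

Lemma ord_geW L T g : (T <= L)%N -> ord_ge L g -> ord_ge T g.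
Proof. by move=> TL gL m mT; apply: gL; apply: leq_trans TL. Qed.

Lemma ord_geM L T f g : ord_ge L f -> ord_ge T g -> ord_ge (L + T) (f * g).
Proof.
move=> fL gT m mLT; rewrite pscoefM big1 // => -[a b] /= /eqP me.
have [aL|La] := ltnP (mdeg a) L; first by rewrite fL ?mul0r.
rewrite gT ?mulr0 // ltnNge; apply/negP => Tb.
by move: mLT; rewrite me mdegD ltnNge leq_add.
Qed.

Lemma ord_ge0 g : ord_ge 0 g. Proof. by []. Qed.

Lemma ord_ge_ideal L : is_ideal (ord_ge L).
Proof.
split=> [m _|f g fL gL m mL|f g gL] //.
  by rewrite pscoefD fL ?gL ?addr0.
by rewrite -[L]add0n; apply: ord_geM.
Qed.

Lemma ord_geX L g : ord_ge 1 g -> ord_ge L (g ^+ L).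
Proof.
by move=> g1; elim: L => [//|L IH]; rewrite exprS -add1n; apply: ord_geM.
Qed.

Lemma ord_ge1P g : ord_ge 1 g <-> pscoef g 0%MM = 0.
Proof.
split=> [-> //|g0 m]; first by rewrite mdeg0.
by rewrite ltnS leqn0 mdeg_eq0 => /eqP ->.
Qed.

Lemma ord_ge_mono m : ord_ge (mdeg m) (psmono m).
Proof. by move=> a am /=; case: eqP am => // ->; rewrite ltnn. Qed.

Lemma ord_ge_psX i : ord_ge 1 (psX i : P).
Proof. by rewrite -[1%N](mdeg1 i); apply: ord_ge_mono. Qed.

Lemma pscoef0M f g : pscoef (f * g) 0%MM = pscoef f 0%MM * pscoef g 0%MM.
Proof.
have [c -> f1] : exists2 c : k, c = pscoef f 0%MM & ord_ge 1 (f - c%:A).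
  exists (pscoef f 0%MM) => //; apply/ord_ge1P.
  by rewrite pscoefB pscoefZ pscoef1 eqxx mulr1 subrr.
rewrite -[f in LHS](subrK (pscoef f 0%MM)%:A) mulrDl pscoefD.
rewrite -scalerAl mul1r pscoefZ.
by rewrite [X in X + _](ord_geM f1 (ord_ge0 g)) ?add0r // mdeg0.
Qed.

(** A monomial other than [1] is given to the first variable that divides it. *)
Lemma ord_ge_decomp L g : ord_ge L.+1 g ->
  exists2 h : 'I_n -> P, g = \sum_j h j * psX j & forall j, ord_ge L (h j).
Proof.
move=> gL; pose first m := [pick i | m i != 0%N].
pose h j := MPSeries (fun m => if first (m + U_(j))%MM == Some j
                               then pscoef g (m + U_(j))%MM else 0).
exists h => [|j m mL] /=; last first.
  by case: ifP => // _; apply: gL; rewrite mdegD mdeg1 addn1.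
apply: mpseriesP => m; rewrite pscoef_sum.
transitivity (\sum_(j < n) if first m == Some j then pscoef g m else 0).
  case em: (first m) => [i|].
    by rewrite (bigD1 i) //= eqxx big1 ?addr0 // => j /negbTE ji;
      rewrite [_ == _]eq_sym [_ == _]ji.
  rewrite big1 // gL //; move: em; rewrite /first.
  case: pickP => // m0 _; suff -> : m = 0%MM by rewrite mdeg0.
  by apply/mnmP => i; rewrite mnm0E; apply/eqP; have /negbFE := m0 i.
apply: eq_bigr => j _; rewrite mulrC psmonoM /=.
case: (boolP (U_(j) <= m)%MM) => [jm|]; first by rewrite submK.
rewrite lep1mP negbK => mj.
case: eqP => // em; move: em; rewrite /first; case: pickP => // i mi [ij].
by rewrite ij mj in mi.
Qed.

Lemma ord_ge_mem (S : P -> Prop) K g : is_ideal S ->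
  (forall m, mdeg m = K -> S (psmono m)) -> ord_ge K g -> S g.
Proof.
move=> SI Sm gK.
suff H : forall L h m, ord_ge L h -> (mdeg m + L = K)%N -> S (h * psmono m).
  by have := H K g 0%MM gK; rewrite mdeg0 psmono0 mulr1; apply.
elim=> [h m _|L IH h m /ord_ge_decomp [c -> cL] mL].
  by rewrite addn0 => /Sm; apply: is_idealMl.
rewrite mulr_suml; apply: is_ideal_sum => // j _.
rewrite -mulrA -psmonoD; apply: IH => //.
by rewrite mdegD mdeg1 -mL; lia.
Qed.

(** ** Truncation *)

Definition ps_poly (p : {mpoly k[n]}) : P := MPSeries (fun m => p@_m).

Lemma ps_poly_trunc L g : ord_ge L (g - ps_poly (pstrunc L g)).
Proof. by move=> m mL; rewrite pscoefB /= mcoeff_pstrunc // subrr. Qed.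

Lemma ps_polyE p : ps_poly p = \sum_(m <- msupp p) p@_m *: psmono m.
Proof.
apply: mpseriesP => m; rewrite pscoef_sum /= [in LHS](mpolyE p) raddf_sum /=.
by apply: eq_bigr => a _; rewrite mcoeffZ mcoeffX eq_sym.
Qed.

(** Up to a series of order [L], a series is a combination of monomials. *)
Lemma series_ind (S : P -> Prop) L :
    (forall g, ord_ge L g -> S g) -> (forall m, S (psmono m)) ->
    (forall (c : k) f g, S f -> S g -> S (c *: f + g)) ->
  forall g, S g.
Proof.
move=> S0 Sm SD g.
rewrite -(subrK (ps_poly (pstrunc L g)) g) -[g - _]scale1r; apply: (SD).
  by apply: (S0); apply: ps_poly_trunc.
rewrite ps_polyE; elim/big_rec: _ => [|m h _ Sh]; last exact: SD.
by apply: S0; apply: is_ideal0 (ord_ge_ideal L).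
Qed.

(** ** Finitely generated ideals are closed *)

Section Closed.
Variables (I : finType) (f : I -> P).

(** The ideal [(f) + m^T], where [m] is the maximal ideal. *)
Definition near_ideal T g := exists2 h, h \in ideal_gen f & ord_ge T (g - h).

Lemma near_ideal_ideal T : is_ideal (near_ideal T).
Proof.
have [F0 FD FM] := ideal_gen_ideal f; have [O0 OD OM] := ord_ge_ideal T.
split=> [|u v [a aF au] [b bF bv]|u v [b bF bv]].
- by exists 0; rewrite ?subr0.
- by exists (a + b); [apply: FD|rewrite opprD addrACA; apply: OD].
- by exists (u * b); [apply: FM|rewrite -mulrBr; apply: OM].
Qed.

Lemma near_ideal_ord T g : ord_ge T g -> near_ideal T g.
Proof.
by exists 0; [apply: is_ideal0 (ideal_gen_ideal f)|rewrite subr0].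
Qed.

Lemma near_idealW L T g : (T <= L)%N -> near_ideal L g -> near_ideal T g.
Proof. by move=> TL [h hf gh]; exists h => //; apply: ord_geW gh. Qed.

Let comb (c : I -> P) := \sum_i c i * f i.

Let comb_lin (a : k) c d : comb (fun i => a *: c i + d i) = a *: comb c + comb d.
Proof.
rewrite scaler_sumr -big_split; apply: eq_bigr => i _.
by rewrite mulrDl scalerAl.
Qed.

Let syz T (c : I -> P) := ord_ge T (comb c).
Let congr_to t (c d : I -> P) := forall i, ord_ge t (c i - d i).

(* For fixed [t], the truncations of the [syz T] modulo [m^t] form a decreasing sequence of
   subspaces of a finite dimensional space. *)
Let syz_stationary t : exists N, forall T, (N <= T)%N -> forall c, syz N c ->
  exists2 d, syz T d & congr_to t c d.
Proof.
pose J := (I * 'X_{1..n < t})%type.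
pose tr (c : I -> P) := \row_(j < #|{: J}|)
  pscoef (c (enum_val j).1) (val (enum_val j).2).
have trP c d : tr c = tr d -> congr_to t c d.
  move=> /rowP e i m mt; have := e (enum_rank (i, BMultinom mt)).
  by rewrite !mxE enum_rankK pscoefB /= => ->; rewrite subrr.
pose S T v := exists2 c, syz T c & v = tr c.
have [|T v [c Tc ->]|N NP] := @subspace_stationary _ _ S.
- move=> T; split=> [|a u v [c Tc ->] [d Td ->]].
    exists (fun=> 0); last by apply/rowP => j; rewrite !mxE.
    rewrite /syz /comb big1 => [|i _]; last by rewrite mul0r.
    exact: is_ideal0 (ord_ge_ideal T).
  exists (fun i => a *: c i + d i); last by apply/rowP => j; rewrite !mxE.
  rewrite /syz comb_lin -[a *: _]mulr_algl.
  apply: is_idealD (ord_ge_ideal T) _ _ _ Td.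
  exact: is_idealMl (ord_ge_ideal T) _ _ Tc.
- by exists c => //; apply: ord_geW Tc.
exists N => T NT c Nc; have [|d Td e] := NP T NT (tr c); first by exists c.
by exists d => //; apply: trP.
Qed.

(** Krull's intersection theorem for [k[[X]]/(f)]. Let [c] solve [g = \sum_i c i
    * f i] modulo [m^(tau t)], and [e] modulo [m^(tau t.+1)]. Then [e - c] is a
    syzygy modulo [m^(tau0 t)], so that modulo [m^t] it agrees with a syzygy [s]
    of higher order; [e - s] solves the equation as well as [e] does and agrees
    with [c] modulo [m^t]. These corrected solutions converge. *)
Theorem ideal_gen_closed_adic g :
  (forall T, near_ideal T g) -> g \in ideal_gen f.
Proof.
move=> gT; have OI := ord_ge_ideal.
have [tau0 tau0P] := choice syz_stationary.
pose tau t := (t + \sum_(s < t.+1) tau0 s)%N.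
have tau0_le t : (tau0 t <= tau t)%N.
  by rewrite /tau big_ord_recr /=; lia.
have tauS t : (tau t <= tau t.+1)%N.
  by rewrite /tau [in leqRHS]big_ord_recr /=; lia.
pose sol T c := ord_ge T (g - comb c).
have solE T : exists c, sol T c.
  by have [h /ideal_genP [c ->] gc] := gT T; exists c.
have step t c : sol (tau t) c -> exists2 d, sol (tau t.+1) d & congr_to t c d.
  move=> sc; have [e se] := solE (tau t.+1).
  have combB c1 c2 : comb (fun i => c1 i - c2 i) = comb c1 - comb c2.
    by rewrite -sumrB; apply: eq_bigr => i _; rewrite mulrBl.
  have sy : syz (tau0 t) (fun i => e i - c i).
    apply: ord_geW (tau0_le t) _; rewrite combB.
    apply: (is_ideal_trans (OI _) (v := g)) => //.
    by apply: (is_ideal_sym (OI _)); apply: ord_geW se.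
  have [|s sT cs] := tau0P t (tau t.+1) _ _ sy.
    by apply: leq_trans (tau0_le t) (tauS t).
  exists (fun i => e i - s i).
    by rewrite /sol combB opprB addrCA addrC; apply: is_idealD (OI _) _ _ se sT.
  move=> i; apply: (is_ideal_sym (OI t)).
  by rewrite addrAC; apply: cs.
have [c0 c0P] : exists c : nat -> I -> P, forall t,
    sol (tau t) (c t) /\ congr_to t (c t) (c t.+1).
  have [c0 s0] := solE (tau 0%N).
  have /choice [next nextP] : forall tc : nat * (I -> P), exists d,
      sol (tau tc.1) tc.2 -> sol (tau tc.1.+1) d /\ congr_to tc.1 tc.2 d.
    move=> [t c]; case: (pselect (sol (tau t) c)) => [/step [d]|nc].
      by exists d.
    by exists c => /nc.
  pose fix seqc t := if t is s.+1 then next (s, seqc s) else c0.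
  have seqP t : sol (tau t) (seqc t).
    elim: t => [//|t IH]; by have [] := nextP (t, seqc t) IH.
  exists seqc => t; split; first exact: seqP.
  by have [] := nextP (t, seqc t) (seqP t).
have c0_le s t : (s <= t)%N -> congr_to s (c0 s) (c0 t).
  elim: t => [|t IH]; first by rewrite leqn0 => /eqP -> i; rewrite subrr.
  rewrite leq_eqVlt => /orP [/eqP -> i|]; first by rewrite subrr.
  rewrite ltnS => st i; apply: (is_ideal_trans (OI s)) (IH st i) _.
  by apply: ord_geW st _; have [_] := c0P t; apply.
pose c i := MPSeries (fun m => pscoef (c0 (mdeg m).+1 i) m).
have cP t : congr_to t c (c0 t).
  move=> i m mt; have := c0_le _ _ mt i m (ltnSn _).
  by rewrite !pscoefB.
apply/ideal_genP; exists c; apply/eqP; rewrite -subr_eq0; apply/eqP.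
apply: mpseriesP => m; set t := (mdeg m).+1.
suff : ord_ge t (g - comb c) by apply.
apply: (is_ideal_trans (OI t) (v := comb (c0 t))).
  by have [s _] := c0P t; apply: ord_geW s; rewrite /tau; lia.
rewrite -sumrB; apply: (is_ideal_sum (OI t)) => i _.
rewrite -mulrBl; apply: is_idealMr (OI t) _ _ _.
exact: (is_ideal_sym (OI t)) (cP t i).
Qed.

(** This is Nakayama's lemma for the [L]-th power of the maximal ideal: the
    inclusion modulo the next power propagates to all higher powers. *)
Lemma ord_ge_nakayama L : (forall g, ord_ge L g -> near_ideal L.+1 g) ->
  forall g, ord_ge L g -> g \in ideal_gen f.
Proof.
move=> LS g gL; apply: ideal_gen_closed_adic => T.
have H s h : ord_ge (L + s) h -> near_ideal (L + s).+1 h.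
  elim: s h => [h|s IH h]; rewrite ?addn0; first exact: LS.
  rewrite addnS => /ord_ge_decomp [c -> cL].
  apply: (is_ideal_sum (near_ideal_ideal _)) => j _.
  have [b bf cb] := IH _ (cL j); exists (b * psX j).
    exact: is_idealMr (ideal_gen_ideal f) _ _ bf.
  by rewrite -mulrBl -addn1; apply: ord_geM cb (ord_ge_psX j).
suff [h hf gh] : near_ideal (L + T) g by exists h => //; apply: ord_geW gh; lia.
elim: T => [|T IH]; first by rewrite addn0; apply: near_ideal_ord.
have [h hf /H [b bf gb]] := IH; rewrite addnS; exists (h + b).
  exact: is_idealD (ideal_gen_ideal f) _ _ hf bf.
by rewrite opprD addrA.
Qed.

End Closed.

(** The partial sums of the geometric series are inverses up to high order. *)
Lemma series_inv (u : P) : pscoef u 0%MM != 0 -> exists v, v * u = 1.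
Proof.
move=> u0; pose f (_ : unit) := u.
suff /principalP [c ->] : 1 \in ideal_gen f by exists c.
apply: ideal_gen_closed_adic => T; pose c := pscoef u 0%MM.
pose v := 1 - c^-1 *: u.
have v1 : ord_ge 1 v.
  by apply/ord_ge1P; rewrite pscoefB pscoefZ pscoef1 eqxx mulVf // subrr.
exists (1 - v ^+ T); last by rewrite opprB addrCA subrr addr0; apply: ord_geX.
have -> : 1 - v ^+ T = (c^-1 *: \sum_(i < T) v ^+ i) * u.
  rewrite -opprB subrX1 -mulNr opprB -scalerAl mulrC scalerAr; congr (_ * _).
  by rewrite /v opprB addrCA subrr addr0.
exact: is_idealMl (ideal_gen_ideal f) _ _ (mem_ideal_gen f tt).
Qed.

End Series.

Arguments ord_ge_ideal {k n} L.
Arguments ord_ge_psX {k n} i.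
Arguments ord_ge0 {k n} g.
Arguments ord_geX {k n} L [g].
Arguments near_ideal_ideal {k n I} f T.
Arguments ideal_gen_closed_adic {k n I f g}.

(** * The kernel of a system of power series *)

Lemma cramer_comb (A : comNzRingType) d (M : 'M[A]_d) (x : 'I_d -> A) j :
  \det M * x j = \sum_i \adj M j i * \sum_l M i l * x l.
Proof.
have := congr1 (fun N : 'M_d => (N *m \col_l x l) j 0) (mul_adj_mx M).
rewrite -mulmxA mul_scalar_mx !mxE => <-.
apply: eq_bigr => i _; rewrite !mxE; congr (_ * _).
by apply: eq_bigr => l _; rewrite mxE.
Qed.

Lemma mpoly_sub_meval (A : comNzRingType) n (a : 'I_n -> A) (p : {mpoly A[n]}) :
  p - p.@[a]%:MP \in ideal_gen (fun j => 'X_j - (a j)%:MP).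
Proof.
set x := fun j => _; have XI := ideal_gen_ideal x.
elim/mpolyind: p => [|c m p _ _ IH].
  by rewrite meval0 mpolyC0 subrr; apply: is_ideal0 XI.
rewrite mevalD mpolyCD opprD addrACA; apply: (is_idealD XI) IH.
rewrite mevalZ mpolyCM -mul_mpolyC -mulrBr; apply: (is_idealMl XI).
rewrite mevalX mpolyXE_id rmorph_prod /=.
elim/big_rec2: _ => [|i u v _ uv]; first by rewrite subrr; apply: is_ideal0 XI.
apply: (is_ideal_subM XI) uv; rewrite rmorphXn /=.
elim: (m i) => [|e IHe]; first by rewrite subrr; apply: is_ideal0 XI.
by rewrite !exprS; apply: (is_ideal_subM XI) IHe; apply: mem_ideal_gen.
Qed.

Section Kernel.
Variables (k : fieldType) (n : nat).
Local Notation P := {mpseries k[n]}.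
Local Notation lift p := (map_mpoly (in_alg P) p).

Lemma psmono_ind (S : P -> Prop) :
  S 1 -> (forall j g, S g -> S (psX j * g)) -> forall m, S (psmono k m).
Proof.
move=> S1 SX m; rewrite psmonoE; elim/big_rec: _ => // i g _ Sg.
elim: (m i) => [|e IH]; first by rewrite mul1r.
by rewrite exprS -mulrA; apply: SX.
Qed.

Lemma ps_polyX j : ps_poly ('X_j : {mpoly k[n]}) = psX j.
Proof. by apply: mpseriesP => m /=; rewrite mcoeffX eq_sym. Qed.

Lemma meval_lift (p : {mpoly k[n]}) : (lift p).@[psX] = ps_poly p.
Proof.
elim/mpolyind: p => [|c m p _ _ IH].
  rewrite !raddf0; apply: mpseriesP => m; by rewrite /= mcoeff0.
have -> : lift (c *: 'X_[m] + p) = c%:A *: 'X_[m] + lift p.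
  apply/mpolyP => a; rewrite mcoeff_map_mpoly /= !mcoeffD !mcoeffZ !mcoeffX.
  rewrite mcoeff_map_mpoly /= scalerDl.
  by case: eqP => _; rewrite ?mulr1 ?mulr0 ?scale0r.
rewrite mevalD IH mevalZ mevalX -psmonoE.
apply: mpseriesP => a; rewrite mulr_algl pscoefD pscoefZ /=.
by rewrite mcoeffD mcoeffZ mcoeffX [a == _]eq_sym.
Qed.

Lemma mderiv_lift j (p : {mpoly k[n]}) : (lift p)^`M(j) = lift p^`M(j).
Proof.
apply/mpolyP => m.
by rewrite mcoeff_deriv !mcoeff_map_mpoly mcoeff_deriv raddfMn.
Qed.

Section Functional.
Variable lam : {scalar P}.

(** [P[Y]] is a module over [k[Y]], and the extension of [lam] to coefficients
    is linear over [k[Y]]; the result is read as a series in [X]. *)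
Definition coef_apply (p : {mpoly P[n]}) : P := MPSeries (fun m => lam p@_m).

Lemma coef_applyB p q : coef_apply (p - q) = coef_apply p - coef_apply q.
Proof. by apply: mpseriesP => m; rewrite pscoefB /= mcoeffB linearB. Qed.

Lemma coef_apply_sum (J : Type) (r : seq J) (F : J -> {mpoly P[n]}) :
  coef_apply (\sum_(i <- r) F i) = \sum_(i <- r) coef_apply (F i).
Proof.
apply: mpseriesP => m; rewrite pscoef_sum /= raddf_sum linear_sum.
by apply: eq_bigr.
Qed.

Lemma coef_applyM p q :
  coef_apply (lift p * q) = ps_poly p * coef_apply q.
Proof.
apply: mpseriesP => m; rewrite pscoefM /= mcoeffM linear_sum.
apply: eq_bigr => -[a b] /= _.
by rewrite mcoeff_map_mpoly /= mulr_algl linearZ.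
Qed.

Lemma coef_applyE g p : coef_apply (g%:MP * p) =
  \sum_(m <- msupp p) lam (g * p@_m) *: psmono k m.
Proof.
apply: mpseriesP => m; rewrite pscoef_sum /= mcoeffCM [in LHS](mpolyE p).
rewrite raddf_sum mulr_sumr linear_sum; apply: eq_bigr => a _ /=.
rewrite mcoeffZ mcoeffX eq_sym; case: eqP => _; first by rewrite !mulr1.
by rewrite !mulr0 linear0.
Qed.

End Functional.

(** Write [F i (Y) - F i (X) = \sum_j Delta i j * (Y_j - X_j)] for truncations
    [F] of [f], and [D = \det Delta]. The [b i] are the monomials of [D] and the
    [a i] their coefficients in [P]. Differentiation shows that [Delta] becomes
    the Jacobian matrix at [Y = X]; at [Y = 0] it becomes [B]. By Cramer's rule
    [(Y_j - X_j) * D] is a combination of the [F i (Y) - F i (X)], so that after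
    applying [lam] to coefficients the multiplication by [X_j] inside [lam] turns
    into the multiplication of the result by [X_j], modulo [(f)]. Hence [u],
    which is [lam] applied to [D], satisfies the last condition. *)
Theorem jacobian_kernel (f : 'I_n -> P) L : (forall i, pscoef (f i) 0%MM = 0) ->
  exists (B : 'M[P]_n) d (a b : 'I_d -> P),
  [/\ forall i, ord_ge L.+1 (f i - \sum_j B i j * psX j),
      ord_ge L (\sum_i a i * b i - jacobian f)
    & forall lam : {scalar P}, (forall g, near_ideal f L g -> lam g = 0) ->
      exists2 u, pscoef u 0%MM = lam (\det B)
        & forall g, near_ideal f L.+1 (g * u - \sum_i lam (g * a i) *: b i)].
Proof.
move=> f0; pose F i := pstrunc L.+1 (f i).
have trunc_f i : ord_ge L.+1 (f i - ps_poly (F i)) by apply: ps_poly_trunc.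
pose x j : {mpoly P[n]} := 'X_j - (psX j)%:MP.
have /choice [Delta DeltaE] : forall i, exists c : 'I_n -> {mpoly P[n]},
    lift (F i) - (ps_poly (F i))%:MP = \sum_j c j * x j.
  by move=> i; apply/ideal_genP; rewrite -meval_lift; apply: mpoly_sub_meval.
pose M := \matrix_(i, j) Delta i j; pose D := \det M.
pose r := in_tuple (msupp D).
exists (map_mx (mcoeff 0%MM) M), (size (msupp D)), (fun i => D@_(tnth r i)),
  (fun i => psmono k (tnth r i)); split.
- move=> i; suff -> : \sum_j map_mx (mcoeff 0%MM) M i j * psX j = ps_poly (F i).
    exact: trunc_f.
  have := congr1 (mcoeff 0%MM) (DeltaE i).
  rewrite mcoeffB mcoeff_map_mpoly /= mcoeff_pstrunc ?mdeg0 // f0 scale0r sub0r.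
  rewrite mcoeffC eqxx mulr1 raddf_sum /= => /eqP; rewrite eqr_oppLR => /eqP ->.
  rewrite -sumrN; apply: eq_bigr => j _; rewrite !mxE.
  rewrite -[LHS]opprK -mulrN; congr (- _).
  rewrite rmorphM /= mcoeffB mcoeffX mcoeffC eqxx mulr1.
  by rewrite mnm1_eq0 sub0r.
- have -> : \sum_i D@_(tnth r i) * psmono k (tnth r i) = D.@[psX].
    by rewrite mevalE (big_tnth _ _ (msupp D)); apply: eq_bigr => i _;
      rewrite psmonoE.
  rewrite /D -det_map_mx /jacobian; apply: (is_ideal_det (ord_ge_ideal L)).
  move=> i j; rewrite !mxE.
  suff H : ord_ge L ((Delta i j).@[psX] - psderiv j (f i)) by exact: H.
  have -> : (Delta i j).@[psX] = ps_poly (F i)^`M(j).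
    have := congr1 (fun p => p^`M(j).@[psX]) (DeltaE i).
    rewrite /= mderivB mderivC subr0 mderiv_lift meval_lift => ->.
    have xX l : (x l).@[psX] = 0 by rewrite mevalB mevalXU mevalC subrr.
    rewrite (big_morph _ (mderivD j) (mderiv0 _ j)).
    rewrite (big_morph _ (mevalD _) (meval0 _)) (bigD1 j) //=.
    rewrite big1 ?addr0 => [|l lj].
      rewrite mderivM mevalD !mevalM xX mulr0 add0r mderivB mderivC subr0.
      have jj : (U_(j) - U_(j) = 0 :> 'X_{1..n})%MM.
        by rewrite -[X in (X - _)%MM]add0m addmK.
      by rewrite mderivX mnm1E eqxx scale1r jj mpolyX0 meval1 mulr1.
    rewrite mderivM mevalD !mevalM xX mulr0 add0r mderivB mderivC subr0.
    by rewrite mderivX mnm1E (negbTE lj) scale0r meval0 mulr0.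
  move=> m mL; rewrite pscoefB /= mcoeff_deriv mcoeff_pstrunc ?subrr //.
  by rewrite mdegD mdeg1 addn1.
move=> lam lamf; have NI := near_ideal_ideal f L.+1.
have FI i : near_ideal f L.+1 (ps_poly (F i)).
  exists (f i); first exact: mem_ideal_gen.
  exact: is_ideal_sym (ord_ge_ideal _) _ _ _.
exists (coef_apply lam D); first by rewrite /= det_map_mx.
have Dx j : D * x j = \sum_i \adj M j i * (lift (F i) - (ps_poly (F i))%:MP).
  rewrite cramer_comb; apply: eq_bigr => i _; rewrite DeltaE; congr (_ * _).
  by apply: eq_bigr => l _; rewrite mxE.
clearbody D; move=> g; pose S g := near_ideal f L.+1 (g * coef_apply lam D -
                                         coef_apply lam (g%:MP * D)).
suff : S g by rewrite /S coef_applyE (big_tnth _ _ (msupp D)).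
apply: (@series_ind _ _ S L.+1) g => [g gL|m|c g h Sg Sh]; rewrite /S.
- apply: near_ideal_ord; apply: is_idealB (ord_ge_ideal _) _ _ _ _.
    exact: is_idealMr (ord_ge_ideal _) _ _ gL.
  suff -> : coef_apply lam (g%:MP * D) = 0 by apply: is_ideal0 (ord_ge_ideal _).
  apply: mpseriesP => m /=; rewrite mcoeffCM lamf //.
  apply: near_ideal_ord; apply: ord_geW (leqnSn L) _.
  exact: is_idealMr (ord_ge_ideal _) _ _ gL.
- apply: (psmono_ind (S := S)) => [|j {}g Sg].
    by rewrite /S mul1r mpolyC1 mul1r subrr; apply: is_ideal0 NI.
  (* By Cramer's rule, [X_j * D] is [Y_j * D] modulo the [F i (Y) - F i (X)]. *)
  have xD : (psX j * g)%:MP * D = lift 'X_j * (g%:MP * D) -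
      \sum_i (lift (F i) * (g%:MP * \adj M j i) -
              (ps_poly (F i))%:MP * (g%:MP * \adj M j i)).
    have -> : \sum_i (lift (F i) * (g%:MP * \adj M j i) -
        (ps_poly (F i))%:MP * (g%:MP * \adj M j i)) = g%:MP * (D * x j).
      by rewrite Dx mulr_sumr; apply: eq_bigr => i _; ring.
    by rewrite map_mpolyX mpolyCM /x; ring.
  rewrite /S xD coef_applyB coef_applyM ps_polyX coef_apply_sum.
  rewrite opprB addrCA -[psX j * g * _]mulrA -mulrBr.
  apply: (is_idealD NI); last exact: is_idealMl NI _ _ Sg.
  apply: (is_ideal_sum NI) => i _; rewrite coef_applyB coef_applyM.
  apply: (is_idealB NI); first exact: is_idealMr NI _ _ (FI i).
  suff -> : coef_apply lam ((ps_poly (F i))%:MP * (g%:MP * \adj M j i)) = 0.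
    exact: is_ideal0 NI.
  apply: mpseriesP => m' /=; rewrite mcoeffCM lamf //.
  apply: is_idealMr (near_ideal_ideal f L) _ _ _.
  by apply: near_idealW (FI i).
- have -> : coef_apply lam ((c *: g + h)%:MP * D) =
      c *: coef_apply lam (g%:MP * D) + coef_apply lam (h%:MP * D).
    apply: mpseriesP => m; rewrite pscoefD pscoefZ /= !mcoeffCM.
    by rewrite mulrDl -scalerAl linearP.
  rewrite mulrDl -scalerAl opprD addrACA -scalerBr.
  rewrite -mulr_algl; apply: (is_idealD NI) Sh.
  exact: is_idealMl NI _ _ Sg.
Qed.

End Kernel.

(** * The Jacobian modulo the ideal *)

Section Jacobian.
Variables (k : fieldType) (n : nat).
Local Notation P := {mpseries k[n]}.
Variable f : 'I_n -> P.
Hypothesis f0 : forall i, pscoef (f i) 0%MM = 0.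

Definition contains_power := exists K, forall g, ord_ge K g -> g \in ideal_gen f.

Lemma scalar_pack (l : P -> k) : scalar l -> exists lam : {scalar P}, lam =1 l.
Proof.
move=> lS; pose lam : {scalar P} := HB.pack l (GRing.isLinear.Build k P k *%R l lS).
by exists lam.
Qed.

Lemma near_ideal_separate L g : ~ near_ideal f L g ->
  exists lam : {scalar P}, (forall h, near_ideal f L h -> lam h = 0) /\ lam g != 0.
Proof.
move=> ng; have NI := near_ideal_ideal f L.
pose tr (h : P) := \row_(j < #|{: 'X_{1..n < L}}|) pscoef h (enum_val j).
have trP h h' : tr h = tr h' -> ord_ge L (h - h').
  move=> /rowP e m mL; have := e (enum_rank (BMultinom mL)).
  by rewrite !mxE enum_rankK pscoefB /= => ->; rewrite subrr.
pose S v := exists2 h, near_ideal f L h & v = tr h.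
have SS : subspace S.
  split=> [|a u v [h hN ->] [h' hN' ->]].
    by exists 0; [apply: is_ideal0 NI|apply/rowP => j; rewrite !mxE].
  exists (a *: h + h'); last by apply/rowP => j; rewrite !mxE.
  rewrite -mulr_algl; apply: (is_idealD NI) hN'.
  exact: is_idealMl NI _ _ hN.
have nS : ~ S (tr g).
  move=> [h hN /trP gh]; apply: ng; apply: (is_idealBl NI) hN.
  exact: near_ideal_ord.
have [phi [phiS phig]] := subspace_separate SS nS.
have [|lam lamE] := @scalar_pack (fun h => (tr h *m phi) 0 0).
  move=> a h h'; have -> : tr (a *: h + h') = a *: tr h + tr h'.
    by apply/rowP => j; rewrite !mxE.
  by rewrite mulmxDl -scalemxAl !mxE.
exists lam; split=> [h hN|]; rewrite lamE.
  by rewrite phiS ?mxE //; exists h.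
by apply: contraNneq phig => g0; apply/eqP/matrixP => i j; rewrite !ord1 g0 mxE.
Qed.

(** Otherwise some functional [lam], which kills [(f) + m^L], does not kill the
    Jacobian [J]. Let [u] be the image of [lam] under the kernel. If [u] is a
    unit, then [m^L] lies in [(f) + m^(L+1)], because [lam] kills [m^L], and
    Nakayama's lemma contradicts the hypothesis. If not, the multiplication by
    [u] is nilpotent on the image of a finite rank operator, and [lam J], which
    is its trace, vanishes. *)
Theorem jacobian_in_ideal : ~ contains_power -> jacobian f \in ideal_gen f.
Proof.
move=> nfin; apply: ideal_gen_closed_adic => L; apply: contrapT => nJ.
have [lam [lamf lamJ]] := near_ideal_separate nJ.
have [B [d [a [b [_ abJ /(_ lam lamf) [u _ uP]]]]]] := jacobian_kernel L f0.
have NI := near_ideal_ideal f L.+1.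
case: (eqVneq (pscoef u 0%MM) 0) => [/ord_ge1P u1|/series_inv [v vu]].
  case/eqP: lamJ; rewrite -[jacobian f](subKr (\sum_i a i * b i)) linearB /=.
  rewrite [X in _ - X]lamf ?subr0; last exact: near_ideal_ord.
  rewrite -[X in lam X]mul1r.
  apply: (dual_trace_nilpotent NI _ uP (s := L)) => [g|h].
    by move=> /(near_idealW (leqnSn L)); apply: lamf.
  rewrite lamf // mul1r; apply: near_ideal_ord.
  exact: is_idealMl (ord_ge_ideal L) _ _ (ord_geX L u1).
apply: nfin; exists L; apply: ord_ge_nakayama => g gL.
rewrite -[g]mulr1 -vu mulrCA; apply: (is_idealMl NI).
have := uP g; rewrite big1 ?subr0 // => i _.
rewrite lamf ?scale0r //; apply: near_ideal_ord.
exact: is_idealMr (ord_ge_ideal L) _ _ gL.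
Qed.

(** ** The residue functional *)

Definition corner K : 'X_{1..n} := [multinom K | i < n].

Lemma coef_corner K i (g : P) (m : 'X_{1..n}) : m i = K ->
  pscoef (g * psX i ^+ K.+1) m = 0.
Proof.
move=> mi; have -> : psX i ^+ K.+1 = psmono k (U_(i) *+ K.+1)%MM.
  rewrite psmonoE (bigD1 i) //= big1 ?mulr1 => [|j /negbTE ji].
    by rewrite mulmnE mnm1E eqxx mul1n.
  by rewrite mulmnE mnm1E eq_sym ji expr0.
rewrite mulrC psmonoM; case: ifP => // /mnm_lepP /(_ i).
by rewrite mulmnE mnm1E eqxx mul1n mi ltnn.
Qed.

(** A row that annihilates [X] contributes nothing: by Cramer's rule
    [X_i \det C] lies in the ideal of the other powers of variables, for which
    the coefficient to be computed vanishes. *)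
Lemma coef_corner_det0 K (C : 'M[P]_n) i :
    \sum_l C i l * psX l = 0 ->
    (forall j, j != i -> \sum_l C j l * psX l = psX j ^+ K.+1) ->
  pscoef (\det C) (corner K) = 0.
Proof.
move=> Ci Cj; have := psmonoM U_(i) (\det C) (corner K + U_(i)).
rewrite lem_addl addmK => <-; rewrite -[psmono k _]/(psX i) mulrC.
rewrite cramer_comb pscoef_sum.
apply: big1 => j _; case: (eqVneq j i) => [->|ji].
  by rewrite Ci mulr0.
by rewrite Cj // coef_corner // mnmDE mnmE mnm1E eq_sym (negbTE ji) addn0.
Qed.

(** The obvious solution is diagonal with entries [X_j^K], whose determinant is
    the monomial [corner K]. Any other is reached from it by changing one row at
    a time, and two possible rows differ by one that annihilates [X]. *)
Lemma coef_corner_det K (C : 'M[P]_n) :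
    (forall j, \sum_l C j l * psX l = psX j ^+ K.+1) ->
  pscoef (\det C) (corner K) = 1.
Proof.
pose Dg : 'M[P]_n := diag_mx (\row_i psX i ^+ K).
have DgX j : \sum_l Dg j l * psX l = psX j ^+ K.+1.
  rewrite (bigD1 j) //= big1 => [|l /negbTE lj]; rewrite !mxE.
    by rewrite eqxx mulr1n addr0 exprSr.
  by rewrite eq_sym lj mulr0n mul0r.
have detDg : pscoef (\det Dg) (corner K) = 1.
  rewrite det_diag; have -> : \prod_i (\row_i psX i ^+ K) 0 i = psmono k (corner K).
    by rewrite psmonoE; apply: eq_bigr => i _; rewrite mxE mnmE.
  by rewrite /= eqxx.
clearbody Dg.
suff H s : (s <= n)%N -> forall C : 'M[P]_n,
    (forall j, \sum_l C j l * psX l = psX j ^+ K.+1) ->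
    (forall j : 'I_n, (s <= j)%N -> row j C = row j Dg) ->
  pscoef (\det C) (corner K) = 1.
  by move=> CX; apply: (H n) => // j; rewrite leqNgt ltn_ord.
elim: s => [_ {}C _ CD|s IH sn {}C CX CD].
  by have -> : C = Dg by apply/row_matrixP => j; apply: CD.
pose i := Ordinal sn.
pose repl (r : 'rV[P]_n) := \matrix_(j, l) if j == i then r 0 l else C j l.
have replE r j l : repl r j l = if j == i then r 0 l else C j l by rewrite mxE.
have replX r j : \sum_l repl r j l * psX l =
    if j == i then \sum_l r 0 l * psX l else psX j ^+ K.+1.
  rewrite -CX; case: ifP => ji; apply: eq_bigr => l _; by rewrite replE ji.
have repl' r : row' i C = row' i (repl r).
  apply/matrixP => j l; rewrite 2!mxE replE.
  by rewrite eq_sym (negbTE (neq_lift i j)).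
have -> : \det C = 1 * \det (repl (row i Dg)) + 1 * \det (repl (row i C - row i Dg)).
  apply: (@determinant_multilinear _ _ _ _ _ i) => //.
  rewrite !scale1r; apply/rowP => l; rewrite [RHS]mxE ![row i (repl _) _ _]mxE.
  rewrite !replE eqxx [(row i _ - _) _ _]mxE [(- row _ _) _ _]mxE.
  by rewrite [RHS]addrC subrK mxE.
have det0 : pscoef (\det (repl (row i C - row i Dg))) (corner K) = 0.
  apply: (@coef_corner_det0 _ _ i) => [|j /negbTE ji]; last by rewrite replX ji.
  rewrite replX eqxx.
  transitivity (\sum_l C i l * psX l - \sum_l Dg i l * psX l).
    by rewrite -sumrB; apply: eq_bigr => l _; rewrite !mxE mulrBl.
  by rewrite CX DgX subrr.
rewrite 2!mul1r pscoefD [X in _ + X]det0 addr0; apply: IH => [|j|j sj].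
- exact: ltnW.
- rewrite replX; case: eqP => // ->.
  by rewrite -DgX; apply: eq_bigr => l _; rewrite mxE.
- apply/rowP => l; rewrite mxE replE [RHS]mxE.
  case: eqP => [->|ji]; first by rewrite mxE.
  have sj' : (s < j)%N.
    by rewrite ltn_neqAle sj andbT; apply/eqP => e; apply: ji; apply: val_inj.
  by have /rowP/(_ l) := CD j sj'; rewrite !mxE.
Qed.

(** Writing [X_i^(K+1) = \sum_j A i j * f j], the functional is the residue
    [h |-> Res (h dX / f)], computed by the transformation law as the
    coefficient of [corner K] in [\det A * h]. Cramer's rule shows that it
    kills [(f)], and [A *m B] is a matrix for the [X_i^(K+1)]. *)
Lemma residue_functional K (B : 'M[P]_n) :
    (forall g, ord_ge K g -> g \in ideal_gen f) ->
    (forall i, f i = \sum_j B i j * psX j) ->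
  exists lam : {scalar P},
    (forall g, g \in ideal_gen f -> lam g = 0) /\ lam (\det B) = 1.
Proof.
move=> fK fB.
have /choice [A AE] : forall i, exists c : 'I_n -> P,
    psX i ^+ K.+1 = \sum_j c j * f j.
  move=> i; apply/ideal_genP; apply: fK; apply: ord_geW (leqnSn K) _.
  exact: ord_geX (ord_ge_psX i).
pose MA := \matrix_(i, j) A i j.
have AX i : \sum_l MA i l * f l = psX i ^+ K.+1.
  by rewrite AE; apply: eq_bigr => l _; rewrite mxE.
have [|lam lamE] := @scalar_pack (fun h => pscoef (\det MA * h) (corner K)).
  by move=> c g h; rewrite mulrDr -scalerAr.
exists lam; split=> [g /ideal_genP [c ->]|]; rewrite lamE.
  rewrite mulr_sumr pscoef_sum; apply: big1 => j _.
  rewrite mulrCA cramer_comb mulr_sumr pscoef_sum; apply: big1 => i _.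
  by rewrite AX mulrA coef_corner // mnmE.
rewrite -det_mulmx; apply: coef_corner_det => i.
rewrite -AX; under eq_bigr => l _ do rewrite mxE mulr_suml.
rewrite exchange_big; apply: eq_bigr => j _ /=.
rewrite fB mulr_sumr; apply: eq_bigr => l _; by rewrite mulrA.
Qed.

(** ** The finite dimensional case *)

(** The functional is the residue, rescaled by the inverse of its image [u]
    under the kernel; [u] is a unit because the residue of [\det B] is [1].
    The last two conditions hold because [lam (g * jacobian f)] is the trace of
    the multiplication by [g] on the quotient. *)
Theorem jacobian_dual : [pchar k] =i pred0 -> contains_power ->
  exists (lam : {scalar P}) d (a b : 'I_d -> P),
  [/\ forall g, g \in ideal_gen f -> lam g = 0,
      forall g, g - \sum_i lam (g * a i) *: b i \in ideal_gen f,
      lam (jacobian f) != 0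
    & forall g, ord_ge 1 g -> lam (g * jacobian f) = 0].
Proof.
move=> k0 [K fK]; have FI := ideal_gen_ideal f.
have near_f L g : (K <= L)%N -> near_ideal f L g -> g \in ideal_gen f.
  move=> KL [h hf gh]; apply: (is_idealBl FI) hf.
  by apply: fK; apply: ord_geW gh.
have [B [d [a [b [fB abJ kernel]]]]] := jacobian_kernel K f0.
have /choice [t tP] : forall i, exists c : 'I_n -> P,
    f i - \sum_j B i j * psX j = \sum_j c j * psX j /\ forall j, ord_ge K (c j).
  by move=> i; have [c cE cK] := ord_ge_decomp (fB i); exists c.
pose B' := \matrix_(i, j) (B i j + t i j).
have fB' i : f i = \sum_j B' i j * psX j.
  have [tE _] := tP i; rewrite -[LHS](subrK (\sum_j B i j * psX j)) tE addrC.
  by rewrite -big_split; apply: eq_bigr => j _; rewrite mxE mulrDl.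
have [res [resf resB']] := residue_functional fK fB'.
have resB : res (\det B) = 1.
  rewrite -resB'; apply/esym/eqP; rewrite -subr_eq0 -linearB /=; apply/eqP/resf.
  apply: (is_ideal_det FI) => i j; rewrite mxE addrAC subrr add0r.
  by apply: fK; have [_] := tP i; apply.
have [|u u0 uP] := kernel res; first by move=> g /near_f H; apply/resf/H.
have [v vu] : exists v, v * u = 1.
  by apply: series_inv; rewrite u0 resB oner_neq0.
have [|lam lamE] := @scalar_pack (fun g => res (v * g)).
  by move=> c g h; rewrite mulrDr -scalerAr linearP.
have lamf g : g \in ideal_gen f -> lam g = 0.
  by move=> gf; rewrite lamE resf //; apply: (is_idealMl FI) gf.
have dual g : g * 1 - \sum_i lam (g * a i) *: b i \in ideal_gen f.
  have -> : \sum_i lam (g * a i) *: b i = \sum_i res (g * v * a i) *: b i.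
    by apply: eq_bigr => i _; rewrite lamE mulrCA mulrA.
  by apply: near_f (leqnSn K) _; have := uP (g * v); rewrite -[g * v * u]mulrA vu.
have lamJ g : lam (g * jacobian f) = lam (g * \sum_i a i * b i).
  apply/esym/eqP; rewrite -subr_eq0 -linearB /= -mulrBr; apply/eqP/lamf.
  by apply: (is_idealMl FI); apply: fK.
exists lam, d, a, b; split=> // [g||g g1].
- by rewrite -[g in X in X - _]mulr1.
- rewrite -[jacobian f]mul1r lamJ mul1r.
  apply: (dual_trace_neq0 FI lamf dual) => //.
  exists (u * \det B); by rewrite lamE mulrA vu mul1r resB oner_neq0.
rewrite lamJ; apply: (dual_trace_nilpotent FI lamf dual (s := K)) => h.
rewrite lamf // mulr1; apply: (is_idealMl FI).
by apply: fK; apply: ord_geX.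
Qed.

Hypothesis k_char0 : [pchar k] =i pred0.
Hypothesis fin : contains_power.

Theorem jacobian_notin_ideal : jacobian f \notin ideal_gen f.
Proof.
have [lam [d [a [b [lamf _ lamJ _]]]]] := jacobian_dual k_char0 fin.
by apply: contra lamJ => /lamf ->.
Qed.

(** The coordinates of [jacobian f * g] are traces of nilpotent operators. *)
Theorem jacobian_socle g : ord_ge 1 g -> jacobian f * g \in ideal_gen f.
Proof.
move=> g1; have FI := ideal_gen_ideal f.
have [lam [d [a [b [_ dual _ lamJ]]]]] := jacobian_dual k_char0 fin.
have := dual (jacobian f * g); rewrite big1 ?subr0 // => i _.
rewrite -mulrA [_ * (_ * _)]mulrC lamJ ?scale0r //.
exact: is_idealMr (ord_ge_ideal 1) _ _ g1.
Qed.

(** Modulo [(f)], an element [h] of the socle is multiplied by any series as by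
    its constant coefficient, so that [h] is [lam h] times an element that does
    not depend on [h]. *)
Theorem socle_jacobian h : (forall j, h * psX j \in ideal_gen f) ->
  exists c : k, h - c *: jacobian f \in ideal_gen f.
Proof.
move=> hX; have FI := ideal_gen_ideal f.
have [lam [d [a [b [lamf dual lamJ _]]]]] := jacobian_dual k_char0 fin.
pose beta := \sum_i pscoef (a i) 0%MM *: b i.
have beta_eq g : (forall j, g * psX j \in ideal_gen f) ->
    g - lam g *: beta \in ideal_gen f.
  move=> gX; suff -> : lam g *: beta = \sum_i lam (g * a i) *: b i by apply: dual.
  rewrite scaler_sumr; apply: eq_bigr => i _; rewrite scalerA mulrC -linearZ /=.
  congr (_ *: _); apply/esym/eqP; rewrite -subr_eq0 -linearB /=; apply/eqP/lamf.
  rewrite -mulr_algr -mulrBr.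
  have /ord_ge_decomp [c -> _] : ord_ge 1 (a i - (pscoef (a i) 0%MM)%:A).
    by apply/ord_ge1P; rewrite pscoefB pscoefZ pscoef1 eqxx mulr1 subrr.
  rewrite mulr_sumr; apply: (is_ideal_sum FI) => j _.
  by rewrite mulrCA; apply: (is_idealMl FI).
have JX j : jacobian f * psX j \in ideal_gen f.
  by apply: jacobian_socle; apply: ord_ge_psX.
exists (lam h / lam (jacobian f)).
have -> : h - (lam h / lam (jacobian f)) *: jacobian f = (h - lam h *: beta) -
    (lam h / lam (jacobian f)) *: (jacobian f - lam (jacobian f) *: beta).
  rewrite scalerBr scalerA mulfVK // opprB addrA.
  by rewrite subrK.
apply: (is_idealB FI); first exact: beta_eq.
rewrite -mulr_algl.
exact: is_idealMl FI _ _ (beta_eq _ JX).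
Qed.

End Jacobian.

(** * Prime ideals and nilpotent elements *)

Section Primes.
Variables (A : comNzRingType) (x : A).

(* Not required to contain [0], so that the union of the empty chain, which is
   empty, qualifies. *)
Let avoiding (S : A -> Prop) :=
  [/\ forall u v, S u -> S v -> S (u + v), forall a u, S u -> S (a * u)
    & forall j, ~ S (x ^+ j)].

Let maximal_avoiding : (forall j, x ^+ j != 0) ->
  exists S, [/\ is_ideal S, forall j, ~ S (x ^+ j)
    & forall w, ~ S w -> exists j s a, S s /\ x ^+ j = s + a * w].
Proof.
move=> xj; have [|S [SA Smax]] := @classical_sets.Zorn_bigcup A avoiding.
  move=> C CA Ctot; split=> [u v [X CX Xu] [Y CY Yv]|a u [X CX Xu]|j [X CX Xj]].
  - have [XY|YX] := Ctot X Y CX CY.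
      by exists Y => //; have [D _ _] := CA Y CY; apply: D => //; apply: XY.
    by exists X => //; have [D _ _] := CA X CX; apply: D => //; apply: YX.
  - by exists X => //; have [_ M _] := CA X CX; apply: M.
  - by have [_ _ N] := CA X CX; apply: N Xj.
have grow S' : (forall u, S u -> S' u) -> avoiding S' -> forall u, S' u -> S u.
  move=> SS' S'A u S'u; apply: contrapT => nSu; apply: (Smax S') => //.
  by split=> [|/(_ u S'u)].
have [SD SM Sx] := SA.
have S0 : S 0.
  apply: (grow (fun u => S u \/ u = 0)) => [u||]; [by left| |by right].
  split=> [u v [Su|->] [Sv|->]|a u [Su| ->]|j [/Sx //|/eqP xj0]].
  - by left; apply: SD.
  - by left; rewrite addr0.
  - by left; rewrite add0r.
  - by right; rewrite addr0.
  - by left; apply: SM.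
  - by right; rewrite mulr0.
  - by move: (xj j); rewrite xj0.
exists S; split=> // w nSw; apply: contrapT => nex; apply: nSw.
apply: (grow (fun u => exists s a, S s /\ u = s + a * w)) => [u Su||].
- by exists u, 0; rewrite mul0r addr0.
- split=> [_ _ [s [a [Ss ->]]] [t [b [St ->]]]|c _ [s [a [Ss ->]]]|j [s [a [Ss xE]]]].
  + by exists (s + t), (a + b); rewrite mulrDl addrACA; split=> //; apply: SD.
  + by exists (c * s), (c * a); rewrite mulrDr mulrA; split=> //; apply: SM.
  + by apply: nex; exists j, s, a.
- by exists 0, 1; rewrite mul1r add0r.
Qed.

(** An ideal that is maximal among those that contain no power of [x] is
    prime. *)
Theorem prime_avoiding : (forall j, x ^+ j != 0) ->
  exists p : prime_idealr A, x \notin p.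
Proof.
move=> /maximal_avoiding [S [SI Sx Smax]].
pose p : {pred A} := fun u => `[< S u >].
have pP u : reflect (S u) (u \in p) by apply: asboolP.
have pI : idealr_closed p.
  split=> [||a u v /pP Su /pP Sv]; first exact/pP/(is_ideal0 SI).
    by apply/pP; rewrite -(expr0 x); apply: Sx.
  by apply/pP; apply: (is_idealD SI) Sv; apply: is_idealMl SI _ _ Su.
have pprime : prime_idealr_closed p.
  move=> u v /pP Suv; apply/orP; apply: contrapT.
  case: (pselect (S u)) => [/pP ->|nSu]; first by apply; left.
  case: (pselect (S v)) => [/pP ->|nSv]; first by apply; right.
  have [i [s [a [Ss xi]]]] := Smax u nSu; have [j [t [b [St xj]]]] := Smax v nSv.
  move=> _; apply: (Sx (i + j)%N); rewrite exprD xi xj.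
  have -> : (s + a * u) * (t + b * v) =
      (t + b * v) * s + (a * u * t + a * b * (u * v)) by ring.
  by apply: (is_idealD SI); [|apply: (is_idealD SI)]; apply: is_idealMl.
pose pr : prime_idealr A := HB.pack (p : A -> bool) (isIdealr.Build A _ pI)
  (isPrimeIdealrClosed.Build A _ pprime).
exists pr; change (x \notin p).
by apply/pP; rewrite -(expr1 x); apply: Sx.
Qed.

End Primes.

Lemma prime_idealrX (A : comNzRingType) (p : prime_idealr A) x j :
  x ^+ j \in p -> x \in p.
Proof.
elim: j => [|j IH]; first by rewrite expr0 idealr1.
by rewrite exprS prime_idealrM => /orP [|].
Qed.

(** * The quotient algebra *)

Section Quotient.
Variables (k : fieldType) (n : nat).
Local Notation P := {mpseries k[n]}.
Variable f : 'I_n -> P.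
Hypothesis f_proper : 1 \notin ideal_gen f.
Local Notation Q := {ideal_quot (proper_gen f_proper)}.
Local Notation pi := (\pi_Q : P -> Q).

Lemma quot_eq0 g : (pi g == 0) = (g \in ideal_gen f).
Proof.
have := @Quotient.idealrBE _ (proper_gen f_proper) g 0; rewrite subr0 => H.
have -> : (g \in ideal_gen f) = (g \in proper_gen f_proper) by [].
by rewrite H -[X in pi g == X](rmorph0 (\pi_Q)).
Qed.

Lemma quot_surj (q : Q) : exists g, q = pi g.
Proof. by exists (repr q); rewrite reprK. Qed.

Lemma quot_scaleE (c : k) g : c *: pi g = pi (c *: g).
Proof. by rewrite -[c *: g]mulr_algl rmorphM. Qed.

Lemma proper_coef0 i : pscoef (f i) 0%MM = 0.
Proof.
apply/eqP/negPn/negP => /series_inv [v vf]; case/negP: f_proper.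
by rewrite -vf; apply: is_idealMl (ideal_gen_ideal f) _ _ (mem_ideal_gen f i).
Qed.

Lemma ideal_gen_coef0 g : g \in ideal_gen f -> pscoef g 0%MM = 0.
Proof.
move=> gf; apply/ord_ge1P; apply: ideal_gen_sub (ord_ge_ideal 1) _ gf => i.
by apply/ord_ge1P/proper_coef0.
Qed.

Let M0 : {pred Q} := fun q => pscoef (repr q) 0%MM == 0.

Let mem_M0 g : (pi g \in M0) = (pscoef g 0%MM == 0).
Proof.
have : pi (repr (pi g) - g) == 0 by rewrite rmorphB /= reprK subrr.
rewrite quot_eq0 => /ideal_gen_coef0/eqP; rewrite pscoefB subr_eq0 => /eqP e.
by rewrite unfold_in /M0 e.
Qed.

Let M0_ideal : idealr_closed M0.
Proof.
split=> [||a u v].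
- by rewrite -(rmorph0 pi) mem_M0.
- by rewrite -(rmorph1 pi) mem_M0 pscoef1 eqxx oner_neq0.
have [a' ->] := quot_surj a; have [u' ->] := quot_surj u.
have [v' ->] := quot_surj v.
rewrite -rmorphM -rmorphD !mem_M0 pscoefD pscoef0M => /eqP -> /eqP ->.
by rewrite mulr0 addr0.
Qed.

Let M0_prime : prime_idealr_closed M0.
Proof.
move=> u v; have [u' ->] := quot_surj u; have [v' ->] := quot_surj v.
by rewrite -rmorphM !mem_M0 pscoef0M mulf_eq0.
Qed.

(** The series without constant term; the [f i] have none, since the ideal is
    proper. *)
Definition quot_max : prime_idealr Q :=
  HB.pack (M0 : Q -> bool) (isIdealr.Build Q _ M0_ideal)
    (isPrimeIdealrClosed.Build Q _ M0_prime).

Lemma mem_quot_max g : (pi g \in quot_max) = (pscoef g 0%MM == 0).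
Proof. exact: mem_M0. Qed.

Lemma quot_unit (q : Q) : q \notin quot_max -> exists r, r * q = 1.
Proof.
have [g ->] := quot_surj q; rewrite mem_quot_max => /series_inv [v vg].
by exists (pi v); rewrite -rmorphM vg rmorph1.
Qed.

Lemma quot_ideal_sub (J : idealr Q) : {subset J <= quot_max}.
Proof.
move=> q qJ; apply: contraT => /quot_unit [r rq].
by have := idealMr r qJ; rewrite rq idealr1.
Qed.

Lemma quot_local : local_ring (quot_max : idealr Q).
Proof.
split=> [J MJ q|J Jmax q]; last by rewrite (Jmax quot_max) //; apply: quot_ideal_sub.
by apply/idP/idP => [/quot_ideal_sub|/MJ].
Qed.

Lemma finite_dim_artinian : finite_dim Q -> artinian Q.
Proof.
move=> [d [e eP]] I Idec; pose v (c : 'rV[k]_d) : Q := \sum_j c 0 j *: e j.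
have [||N NP] := @subspace_stationary _ _ (fun i c => v c \in I i).
- move=> i; split=> [|a c c' cI c'I].
    by rewrite /v big1 ?idealr0 // => j _; rewrite mxE scale0r.
  have -> : v (a *: c + c') = pi a%:A * v c + v c'.
    rewrite /v mulr_sumr -big_split; apply: eq_bigr => j _ /=.
    by rewrite !mxE scalerDl -scalerA.
  by rewrite rpredD // idealMr.
- by move=> i c /Idec.
exists N => i Ni q; apply/idP/idP.
  by move: Ni => /subnK <-; elim: (i - N)%N => // l IH /Idec.
have [c ->] := eP q; have := NP i Ni (\row_j c j); rewrite /v.
by under eq_bigr => j _ do rewrite mxE.
Qed.

(** When the ideals of powers stabilize, [q ^+ N.+1 * (1 - c * q) = 0], and the
    second factor is a unit. *)
Lemma artinian_nilpotent (q : Q) : artinian Q -> q \in quot_max ->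
  exists N, q ^+ N = 0.
Proof.
move=> art qM; pose I i := ideal_gen (fun _ : unit => q ^+ i.+1).
have I1 i : 1 \notin I i.
  apply/negP => /principalP [c e]; have := idealr1 quot_max.
  by rewrite e exprS mulrCA -[X in X \in _]mulrC idealMr.
have [|N NP] := art (fun i => proper_gen (I1 i)).
  move=> i u /principalP [c ->]; apply/principalP; exists (c * q).
  by rewrite exprS mulrA.
exists N.+1; have /principalP [c qE] : q ^+ N.+1 \in I N.+1.
  by rewrite (NP N.+1 (leqnSn N)); apply/principalP; exists 1; rewrite mul1r.
have /quot_unit [r rq] : 1 - c * q \notin quot_max.
  apply/negP => H; have := idealr1 quot_max; rewrite -(subrK (c * q) 1).
  by rewrite rpredD // idealMr.
rewrite -[LHS]mul1r -rq -mulrA mulrBl mul1r -mulrA -exprS -qE subrr.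
by rewrite mulr0.
Qed.

(** A monomial of large degree has a large exponent. *)
Lemma nilpotent_contains_power :
  (forall j, exists N, pi (psX j) ^+ N = 0) -> contains_power f.
Proof.
move=> /choice [N NP]; pose T := (\sum_j N j)%N.
exists (n * T).+1 => g; apply: ord_ge_mem (ideal_gen_ideal f) _ => m mK.
have [j Tj] : exists j, (T <= m j)%N.
  apply: contrapT => nex; have : (mdeg m <= n * T)%N.
    rewrite mdegE -[n in leqRHS]card_ord -sum_nat_const; apply: leq_sum => j _.
    by apply: ltnW; rewrite ltnNge; apply/negP => Tj; apply: nex; exists j.
  by rewrite mK ltnn.
have Nj : (N j <= m j)%N.
  by apply: leq_trans Tj; rewrite /T (bigD1 j) //= leq_addr.
rewrite psmonoE (bigD1 j) //= -(subnK Nj) exprD -mulrA mulrCA.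
apply: (is_idealMr (ideal_gen_ideal f)).
by rewrite -quot_eq0 rmorphXn NP.
Qed.

Lemma contains_power_finite_dim : contains_power f -> finite_dim Q.
Proof.
move=> [K fK]; pose mono (j : 'I_#|{: 'X_{1..n < K}}|) : 'X_{1..n} := enum_val j.
exists #|{: 'X_{1..n < K}}|, (fun j => pi (psmono k (mono j))) => q.
exists (fun j => pscoef (repr q) (mono j)).
transitivity (\sum_(a : 'X_{1..n < K}) pscoef (repr q) a *: pi (psmono k a));
  last first.
  rewrite (reindex (fun j : 'I_#|{: 'X_{1..n < K}}| => enum_val j)) //.
  by apply: onW_bij; apply: enum_val_bij.
under eq_bigr => a _ do rewrite quot_scaleE.
rewrite -rmorph_sum -[LHS]reprK; apply/eqP; rewrite -subr_eq0 -rmorphB.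
rewrite quot_eq0; apply: fK => m mK; rewrite pscoefB pscoef_sum.
rewrite (bigD1 (BMultinom mK)) //= eqxx mulr1 big1 ?addr0 ?subrr // => a am.
case: eqP => [e|]; last by rewrite mulr0.
by case/eqP: am; apply: val_inj.
Qed.

Lemma finite_dim_contains_power : finite_dim Q -> contains_power f.
Proof.
move=> fd; apply: nilpotent_contains_power => j.
apply: artinian_nilpotent (finite_dim_artinian fd) _.
by rewrite mem_quot_max; apply/eqP/ord_ge1P/ord_ge_psX.
Qed.

(** A prime contains the nilpotent classes of the [X_j], hence the maximal
    ideal. *)
Lemma contains_power_primes (p : prime_idealr Q) : contains_power f -> p =i quot_max.
Proof.
move=> [K fK] q; apply/idP/idP; first exact: quot_ideal_sub.
have [g ->] := quot_surj q; rewrite mem_quot_max => /eqP/ord_ge1P.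
move=> /ord_ge_decomp [c -> _]; rewrite rmorph_sum rpred_sum // => j _.
rewrite rmorphM idealMr //; apply: (@prime_idealrX _ _ _ K).
suff e : pi (psX j) ^+ K = 0 by rewrite e idealr0.
apply/eqP; rewrite -rmorphXn quot_eq0; apply: fK.
exact: ord_geX (ord_ge_psX j).
Qed.

Lemma contains_power_chain d : contains_power f -> has_prime_chain Q d -> d = 0%N.
Proof.
case: d => // d cp [p /(_ 0%N (ltn0Sn d)) [_ []] q].
by rewrite !(contains_power_primes _ cp).
Qed.

Lemma prime_chain0 : has_prime_chain Q 0.
Proof. by exists (fun=> quot_max). Qed.

Lemma prime_chain1 : ~ contains_power f -> has_prime_chain Q 1.
Proof.
move=> ncp; have [j jP] : exists j, forall N, pi (psX j) ^+ N != 0.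
  apply: contrapT => nex; apply: ncp; apply: nilpotent_contains_power => j.
  apply: contrapT => nN; apply: nex; exists j => N.
  by apply/eqP => e; apply: nN; exists N.
have [p jp] := prime_avoiding jP.
exists (fun i => if i == 0%N then p else quot_max) => -[|//] _ /=.
split; first exact: quot_ideal_sub.
move=> /(_ (pi (psX j))) H; case/negP: jp; apply: H.
by rewrite mem_quot_max; apply/eqP/ord_ge1P/ord_ge_psX.
Qed.

End Quotient.

Theorem mainTheorem1 (k : fieldType) (k_char0 : [pchar k] =i pred0) (n : nat)
    (f : 'I_n -> {mpseries k[n]}) (f_proper : 1 \notin ideal_gen f) :
  let Q := {ideal_quot (proper_gen f_proper)} in
  [/\ krull_dim_gt Q 0 <-> jacobian f \in ideal_gen f,
      finite_dim Q <-> krull_dim Q 0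
    & finite_dim Q ->
      (forall g, g \in ideal_gen (@psX n k) -> jacobian f * g \in ideal_gen f)
      /\ artinian Q
      /\ exists2 M : idealr Q, local_ring M
           & socle M =i ideal_gen (fun _ : unit => \pi_Q (jacobian f))].
Proof.
move=> Q; have f0 := proper_coef0 f_proper; have FI := ideal_gen_ideal f.
split=> [||fd].
- split=> [[d d0 ch]|Jf].
    apply: jacobian_in_ideal => // cp.
    by move: d0; rewrite (contains_power_chain cp ch).
  exists 1%N => //; apply: prime_chain1 => cp.
  by case/negP: (jacobian_notin_ideal f0 k_char0 cp).
- split=> [/finite_dim_contains_power cp|[_ dim0]].
    split=> [|e /(contains_power_chain cp) -> //]; exact: prime_chain0.
  apply: contains_power_finite_dim; apply: contrapT => /prime_chain1.
  by move=> /(_ f_proper)/dim0.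
have cp := finite_dim_contains_power fd.
have Jm g : ord_ge 1 g -> jacobian f * g \in ideal_gen f.
  exact: jacobian_socle.
split; last split; first 1 last.
- exact: finite_dim_artinian.
- exists (quot_max f_proper : idealr Q); first exact: quot_local.
  move=> q; have [h ->] := quot_surj q; apply/asboolP/principalP.
    move=> hS; have [j|c hc] := @socle_jacobian _ _ f f0 k_char0 cp h.
      rewrite -(quot_eq0 f_proper) mulrC rmorphM; apply/eqP/hS.
      by rewrite mem_quot_max; apply/eqP/ord_ge1P/ord_ge_psX.
    exists (\pi_Q c%:A); rewrite -rmorphM mulr_algl.
    by apply/eqP; rewrite -subr_eq0 -rmorphB quot_eq0.
  move=> [c ->] m; have [g ->] := quot_surj m; rewrite mem_quot_max.
  move=> /eqP/ord_ge1P/Jm; rewrite -(quot_eq0 f_proper) rmorphM => /eqP e.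
  by rewrite mulrCA [_ * \pi _]mulrC e mulr0.
move=> g /(ideal_gen_sub (ord_ge_ideal 1)) gX; apply: Jm; apply: gX => i.
exact: ord_ge_psX.
Qed.
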